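(* Let $D$ be a finite set with $|D|\geq 2$, let $P:D^2\to\{0,1\}$ be a binary predicate, and let $0<\varepsilon<1$. (1) If there exist two-element subsets $B,C\subseteq D$ (not necessarily disjoint) such that the restriction $P|_{B\times C}$ is a singleton, then there exists an instance $I$ of $\mathrm{CSP}(P)$ such that every $\varepsilon$-sparsifier of $I$ has $\Omega(n^2)$ constraints, where $n$ is the number of variables of $I$ (i.e., there is a constant $c>0$ such that for infinitely many $n$ there is an instance on $n$ variables all of whose $\varepsilon$-sparsifiers have at least $cn^2$ constraints). (2) Otherwise (i.e., if $P|_{B\times C}$ is not a singleton for any two-element subsets $B,C\subseteq D$), for every instance $I$ of $\mathrm{CSP}(P)$ on $n$ variables there exists an $\varepsilon$-sparsifier of $I$ with $O(\varepsilon^{-2}n)$ constraints, where the implied constant does not depend on $I$, $n$ or $\varepsilon$.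
   Context: A binary CSP instance is $I=(V,D,\Pi,w)$ where $V$ is a finite set of $n=|V|$ variables, $D$ a finite domain, $\Pi$ a set of constraints, each a pair $\langle (u,v),P\rangle$ with $u,v\in V$ distinct and $P:D^2\to\{0,1\}$, and $w:\Pi\to\mathbb{R}_{>0}$ positive weights. $\mathrm{CSP}(P)$ is the class of instances in which every constraint uses the predicate $P$. For an assignment $A:V\to D$, $\mathrm{Val}_I(A)=\sum_{\pi=\langle(u,v),P\rangle\in\Pi} w(\pi)P(A(u),A(v))$. For $0<\varepsilon<1$, an $\varepsilon$-sparsifier of $I$ is an instance $I_\varepsilon=(V,D,\Pi_\varepsilon,w_\varepsilon)$ with $\Pi_\varepsilon\subseteq\Pi$ and $w_\varepsilon:\Pi_\varepsilon\to\mathbb{R}_{>0}$ such that for every $A:V\to D$, $(1-\varepsilon)\mathrm{Val}_I(A)\le \mathrm{Val}_{I_\varepsilon}(A)\le(1+\varepsilon)\mathrm{Val}_I(A)$; its number of constraints is $|\Pi_\varepsilon|$. A predicate is a singleton if exactly one tuple is mapped to $1$. For $B,C\subseteq D$, $P|_{B\times C}$ denotes the restriction of $P$ to $B\times C$. *)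

(* Defs.v *)
From HB Require Import structures.
From mathcomp Require Import all_boot all_order all_algebra.
From mathcomp Require Import reals.
Set Implicit Arguments. Unset Strict Implicit. Unset Printing Implicit Defensive.
Import Order.TTheory GRing.Theory Num.Theory.
Local Open Scope ring_scope.

(* An instance of CSP(P) on the variable set 'I_n is encoded by its weight
   function w : 'I_n -> 'I_n -> R: the constraint <(u,v),P> belongs to Pi
   iff w u v != 0, and then its weight is w u v > 0.  Constraints on
   (u,u) are forbidden (u,v must be distinct). *)
Definition is_instance (R : realType) (n : nat) (w : 'I_n -> 'I_n -> R) : Prop :=
  forall u v : 'I_n, 0 <= w u v /\ (u = v -> w u v = 0).

Definition csp_val (R : realType) (D : finType) (P : D -> D -> bool) (n : nat)
  (w : 'I_n -> 'I_n -> R) (A : 'I_n -> D) : R :=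
  \sum_(u : 'I_n) \sum_(v : 'I_n) w u v * (P (A u) (A v))%:R.

Definition num_constraints (R : realType) (n : nat) (w : 'I_n -> 'I_n -> R) : nat :=
  #|[set p : 'I_n * 'I_n | w p.1 p.2 != 0]|.

Definition is_sparsifier (R : realType) (D : finType) (P : D -> D -> bool) (n : nat)
  (eps : R) (w w' : 'I_n -> 'I_n -> R) : Prop :=
  (forall u v : 'I_n, 0 <= w' u v) /\
  (forall u v : 'I_n, w u v = 0 -> w' u v = 0) /\
  (forall A : 'I_n -> D,
      (1 - eps) * csp_val P w A <= csp_val P w' A /\
      csp_val P w' A <= (1 + eps) * csp_val P w A).

Definition has_singleton_restriction (D : finType) (P : D -> D -> bool) : Prop :=
  exists B C : {set D}, #|B| = 2%N /\ #|C| = 2%N /\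
    #|[set p in setX B C | P p.1 p.2]| = 1%N.

(* Main.v *)
Require Import Defs.
From HB Require Import structures.
From mathcomp Require Import all_boot all_order all_algebra.
From mathcomp Require Import reals.
From mathcomp Require Import ring lra.
Import Order.TTheory GRing.Theory Num.Theory.
Local Open Scope ring_scope.

(* A singleton restriction lets an assignment satisfy exactly one constraint of
   the complete bipartite instance, so no constraint of it can be dropped.
   Without singleton restrictions the zero sets of the rows of P are pairwise
   equal or disjoint, hence P a b = (f a != g b) for some colourings f and g,
   and the value of an assignment is half the sum, over the colours, of cut
   weights in the bipartite double cover. A spectral sparsifier of the double
   cover therefore suffices. It is built as by Batson, Spielman and Srivastava:
   put the edge vectors in isotropic position and add rank-one terms one at a
   time, moving an upper barrier u by 1 + 4 th and a lower barrier l by 1, while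
   tr (u - A)^-1 and tr (A - l)^-1 stay at most th = eps / 5. *)

(** * Positive definite matrices *)

(** The trace reads off the entry of a 1 by 1 matrix; being cyclic, it lets such values be rewritten
    as traces of square matrices. *)
Definition posdef {R : realFieldType} {n : nat} (M : 'M[R]_n) : Prop :=
  M^T = M /\ forall x : 'rV[R]_n, x != 0 -> 0 < \tr (x *m M *m x^T).

Lemma mx11_scalar_tr {R : realFieldType} (A : 'M[R]_1) : A = (\tr A)%:M.
Proof. by rewrite [in RHS](mx11_scalar A) mxtrace_scalar -mx11_scalar. Qed.

Section PositiveDefinite.
Context {R : realFieldType} {n : nat}.
Implicit Types (M N A : 'M[R]_n) (x v : 'rV[R]_n) (t c d : R).

Lemma tr_mul_mul_tr m (N : 'M[R]_(m, n)) M :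
  \tr (N *m M *m N^T) = \sum_i \tr (row i N *m M *m (row i N)^T).
Proof.
apply: eq_bigr => i _; rewrite [RHS]/mxtrace big_ord1 -row_mul tr_row.
by rewrite !mxE; apply: eq_bigr => j _; rewrite !mxE.
Qed.

Lemma posdef_ge0 M x : posdef M -> 0 <= \tr (x *m M *m x^T).
Proof.
case=> _ Mpos; have [->|/Mpos/ltW//] := eqVneq x 0.
by rewrite !mul0mx mxtrace0.
Qed.

Lemma posdef_tr_ge0 m (N : 'M[R]_(m, n)) M :
  posdef M -> 0 <= \tr (N *m M *m N^T).
Proof.
move=> Mpos; rewrite tr_mul_mul_tr; apply: sumr_ge0 => i _.
exact: posdef_ge0.
Qed.

Lemma posdef_tr_gt0 m (N : 'M[R]_(m, n)) M :
  posdef M -> N != 0 -> 0 < \tr (N *m M *m N^T).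
Proof.
move=> Mpos N0; have [i Ni0] : exists i, row i N != 0.
  apply/existsP; apply: contraR N0; rewrite negb_exists => /forallP N0.
  by apply/eqP/row_matrixP => i; rewrite row0; apply/eqP/negPn/N0.
rewrite tr_mul_mul_tr (bigD1 i)//= ltr_pwDl ?(proj2 Mpos)//.
by apply: sumr_ge0 => j _; apply: posdef_ge0.
Qed.

Lemma posdef_unit M : posdef M -> M \in unitmx.
Proof.
case=> _ Mpos; rewrite -row_free_unit -kermx_eq0; apply/eqP/row_matrixP => i.
rewrite row0; apply/eqP/negPn/negP => /Mpos.
by rewrite -row_mul mulmx_ker row0 mul0mx mxtrace0 ltxx.
Qed.

Lemma posdef_inv M : posdef M -> posdef (invmx M).
Proof.
move=> Mpos; have Mu := posdef_unit _ Mpos; have [Msym _] := Mpos.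
have Isym : (invmx M)^T = invmx M by rewrite trmx_inv Msym.
split=> // x x0; have -> : x *m invmx M *m x^T =
    x *m invmx M *m M *m (x *m invmx M)^T.
  by rewrite trmx_mul Isym mulmxKV// !mulmxA.
by apply: (proj2 Mpos); apply: contraNneq x0 => e; rewrite -(mulmxKV Mu x) e mul0mx.
Qed.

Lemma posdef_scalar c : 0 < c -> posdef (c%:M : 'M[R]_n).
Proof.
move=> c0; split=> [|x x0]; first by rewrite tr_scalar_mx.
rewrite mul_mx_scalar -scalemxAl mxtraceZ mulr_gt0//.
have /existsP[j xj0] : [exists j, x 0 j != 0].
  apply: contraR x0; rewrite negb_exists => /forallP x0.
  by apply/eqP/rowP => j; rewrite mxE; apply/eqP/negPn/x0.
rewrite /mxtrace big_ord1 mxE (bigD1 j)//= ltr_pwDl//.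
  by rewrite mxE -expr2 exprn_even_gt0.
by apply: sumr_ge0 => k _; rewrite mxE -expr2 sqr_ge0.
Qed.

Lemma posdefD M N : posdef M -> posdef N -> posdef (M + N).
Proof.
move=> [Ms Mp] [Ns Np]; split=> [|x x0]; first by rewrite linearD/= Ms Ns.
by rewrite mulmxDr mulmxDl mxtraceD addr_gt0 ?Mp ?Np.
Qed.

(** * Rank-one updates *)

Lemma tr_rank1 x v : \tr (x *m (v^T *m v) *m x^T) = \tr (x *m v^T) ^+ 2.
Proof.
have -> : x *m (v^T *m v) *m x^T = (x *m v^T) *m (x *m v^T)^T.
  by rewrite trmx_mul trmxK !mulmxA.
rewrite [x *m v^T]mx11_scalar tr_scalar_mx -scalar_mxM.
by rewrite !mxtrace_scalar expr2.
Qed.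

Lemma posdef_add_rank1 M v t :
  0 <= t -> posdef M -> posdef (M + t *: (v^T *m v)).
Proof.
move=> t0 [Ms Mp]; split=> [|x x0].
  by rewrite linearD linearZ/= trmx_mul trmxK Ms.
rewrite mulmxDr mulmxDl mxtraceD ltr_pwDl ?Mp// -scalemxAr -scalemxAl mxtraceZ.
by rewrite tr_rank1 mulr_ge0 ?sqr_ge0.
Qed.

(** Completing the square: with p = x v^T and b = v M^-1 v^T, the form of M^-1 at x M - t p v gives
    x M x^T - 2 t p^2 + t^2 p^2 b >= 0. As t b < 1, this forces x M x^T > t p^2 when p is nonzero; p
    = 0 is immediate. *)
Lemma posdef_sub_rank1 M v t : 0 < t -> posdef M ->
  t * \tr (v *m invmx M *m v^T) < 1 -> posdef (M - t *: (v^T *m v)).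
Proof.
move=> t0 Mpos tb; have Mu := posdef_unit _ Mpos; have [Ms Mp] := Mpos.
split=> [|x x0]; first by rewrite linearB linearZ/= trmx_mul trmxK Ms.
rewrite mulmxBr mulmxBl raddfB/= -scalemxAr -scalemxAl mxtraceZ tr_rank1.
set b := \tr (v *m _ *m _) in tb; set p := \tr (x *m v^T).
have := posdef_ge0 _ (x *m M - (t * p) *: v) (posdef_inv _ Mpos).
have pE : \tr (v *m x^T) = p by rewrite -mxtrace_tr trmx_mul trmxK.
have -> : \tr ((x *m M - (t * p) *: v) *m invmx M *m (x *m M - (t * p) *: v)^T)
    = \tr (x *m M *m x^T) - 2 * (t * p) * p + (t * p) ^+ 2 * b.
  rewrite [(_ - _)^T]linearB/= [(_ *: v)^T]linearZ/= trmx_mul Ms !mulmxBl mulmxBr.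
  rewrite mulmxK// -!scalemxAl.
  rewrite mulmxBr -!scalemxAr !mulmxA mulmxKV// !raddfB/= !mxtraceZ -/p -/b pE.
  by ring.
have := Mp x x0; have [p0|p0] := eqVneq p 0; first by rewrite p0; nra.
have : 0 < t * p ^+ 2 by rewrite mulr_gt0// exprn_even_gt0.
by nra.
Qed.

Lemma mul_sherman_morrison M v c (G := invmx M) :
  M \in unitmx -> 1 + c * \tr (v *m G *m v^T) != 0 ->
  (M + c *: (v^T *m v)) *m
    (G - (c / (1 + c * \tr (v *m G *m v^T))) *: (G *m v^T *m v *m G)) = 1%:M.
Proof.
move=> Mu; set b := \tr _; move=> k0.
have bE : v *m G *m v^T = b%:M.
  exact: mx11_scalar_tr.
set k := c / _.
rewrite mulmxBr 2!mulmxDl mulmxV// -!scalemxAr -!scalemxAl !mulmxA mulmxV// mul1mx.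
have -> : v^T *m v *m G *m v^T *m v *m G = b *: (v^T *m v *m G).
  by rewrite -!mulmxA (mulmxA v) (mulmxA (v *m G)) bE mul_scalar_mx -scalemxAr.
rewrite !scalerA -scalerDl.
have -> : k + k * c * b = c by rewrite -mulrA -[X in X + _]mulr1 -mulrDr /k divfK.
by rewrite addrK.
Qed.

Lemma tr_inv_rank1 M v c (G := invmx M) :
  M \in unitmx -> 1 + c * \tr (v *m G *m v^T) != 0 ->
  \tr (invmx (M + c *: (v^T *m v))) =
  \tr G - c / (1 + c * \tr (v *m G *m v^T)) * \tr (v *m (G *m G) *m v^T).
Proof.
move=> Mu k0; have MG := mul_sherman_morrison _ _ _ Mu k0.
have [Nu _] := mulmx1_unit MG.
rewrite -[invmx _]mulmx1 -[in LHS]MG mulKmx// raddfB/= mxtraceZ.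
have -> : \tr (v *m (G *m G) *m v^T) = \tr (G *m v^T *m v *m G) => //.
by rewrite -(mulmxA (G *m v^T)) [RHS]mxtrace_mulC !mulmxA.
Qed.

(** * Resolvents under scalar shifts *)

Lemma inv_sub_inv_shift M d : M \in unitmx -> M + d%:M \in unitmx ->
  invmx M - invmx (M + d%:M) = d *: (invmx M *m invmx (M + d%:M)).
Proof.
move=> Mu Nu; rewrite -[X in X - _](mulmxK Nu) mulmxDr mulVmx//.
rewrite mul_mx_scalar mulmxDl mul1mx -scalemxAl.
by rewrite addrC addKr.
Qed.

(** With X = M^-1 and G = (M + d)^-1, the resolvent identity X - G = d X G used twice gives tr X -
    tr G = d tr G^2 + d^2 tr (G X G), and the last trace is nonnegative. *)
Lemma tr_inv_shift M d : 0 < d -> posdef M -> posdef (M + d%:M) ->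
  d * \tr (invmx (M + d%:M) *m invmx (M + d%:M))
    <= \tr (invmx M) - \tr (invmx (M + d%:M)).
Proof.
move=> d0 Mp Np; have := inv_sub_inv_shift _ d (posdef_unit _ Mp) (posdef_unit _ Np).
have := posdef_tr_ge0 _ (invmx (M + d%:M)) _ (posdef_inv _ Mp).
have [-> _] := posdef_inv _ Np.
set X := invmx M; set G := invmx _ => ge0 XG.
rewrite -raddfB/= XG mxtraceZ ler_pM2l//.
have -> : X *m G = G *m G + d *: (X *m G *m G).
  by rewrite scalemxAl -XG -mulmxDl addrC subrK.
rewrite mxtraceD lerDl mxtraceZ mulr_ge0 ?(ltW d0)//.
by rewrite mxtrace_mulC mulmxA in ge0; rewrite -mulmxA mxtrace_mulC.
Qed.

(** With Y = M^-1, Z = (M + d)^-1 and a = tr (Y Z), the form of Z on the rows of Y - d a I, together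
    with d tr Z <= 1, gives tr (Y Z Y) >= d a^2. The resolvent identity turns the two sides of the
    claim into d a + d (d a)^2 and d a + d^2 tr (Y Z Y). The quadratic gain is what keeps the lower
    potential under control. *)
Lemma tr_inv_shift_sqr M d : 0 < d -> posdef M -> posdef (M + d%:M) ->
  d * \tr (invmx (M + d%:M)) <= 1 ->
  \tr (invmx M) - \tr (invmx (M + d%:M))
    + d * (\tr (invmx M) - \tr (invmx (M + d%:M))) ^+ 2
    <= d * \tr (invmx M *m invmx M).
Proof.
move=> d0 Mp Np; have := inv_sub_inv_shift _ d (posdef_unit _ Mp) (posdef_unit _ Np).
have := posdef_inv _ Np; have [Ms _] := posdef_inv _ Mp.
set Y := invmx M in Ms *; set Z := invmx _ => Zp YZ Z1.
pose a := \tr (Y *m Z).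
have := posdef_tr_ge0 _ (Y - (d * a)%:M) _ Zp.
rewrite linearB/= tr_scalar_mx Ms mulmxBl mulmxBr mul_mx_scalar mulmxBl.
rewrite !mul_scalar_mx -scalemxAl !raddfB/= !mxtraceZ.
rewrite -(mxtrace_mulC Y Z) -/a => h.
have YY : \tr (Y *m Y) = a + d * \tr (Y *m Z *m Y).
  have -> : Y *m Y = Y *m Z + d *: (Y *m Y *m Z).
    by rewrite -mulmxA scalemxAr -YZ -mulmxDr addrC subrK.
  by rewrite mxtraceD mxtraceZ -(mulmxA Y Y Z) (mxtrace_mulC Y (Y *m Z)).
have dE : \tr Y - \tr Z = d * a by rewrite -raddfB/= YZ mxtraceZ.
rewrite dE YY.
have da : 0 <= d * a ^+ 2 by rewrite mulr_ge0 ?sqr_ge0 ?(ltW d0).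
have := ler_wpM2l da Z1; rewrite mulr1 => h1.
have qa : d * a ^+ 2 <= \tr (Y *m Z *m Y) by nra.
have := ler_wpM2l (ltW (mulr_gt0 d0 d0)) qa; nra.
Qed.

(** The trace bound puts every eigenvalue of M above d. Eigenvalues are avoided: with s = x x^T, the
    form of M^-1 on the rows of d s I - x^T x M is nonnegative, which yields s (x M x^T - d s) >
    0. *)
Lemma posdef_shift M d : 0 < d -> posdef M -> d * \tr (invmx M) < 1 ->
  posdef (M - d%:M).
Proof.
move=> d0 Mp M1; have [Ms Mpos] := Mp; have Mu := posdef_unit _ Mp.
split=> [|x x0]; first by rewrite linearB/= Ms tr_scalar_mx.
set q := \tr _; pose s := \tr (x *m x^T).
have s0 : 0 < s by have := (posdef_scalar 1 ltr01).2 x x0; rewrite mulmx1.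
have sE : x *m x^T = s%:M.
  exact: mx11_scalar_tr.
have -> : q = \tr (x *m M *m x^T) - d * s.
  by rewrite /q mulmxBr mulmxBl raddfB/= mul_mx_scalar -scalemxAl mxtraceZ.
have := posdef_tr_ge0 _ ((d * s)%:M - x^T *m x *m M) _ (posdef_inv _ Mp).
rewrite [(_ - _)^T]linearB/= tr_scalar_mx !trmx_mul trmxK Ms.
rewrite mulmxBl mul_scalar_mx mulmxK// mulmxBr mul_mx_scalar mulmxBl.
rewrite -scalemxAl !mulmxA mulVmx// mul1mx.
rewrite !raddfB/= !mxtraceZ -[x^T *m x *m M *m _ *m _]mulmxA.
rewrite -[_ *m M *m (x^T *m x)]mulmxA (mxtrace_mulC _ (M *m _)) !mulmxA.
rewrite -(mulmxA (M *m x^T)) sE mul_mx_scalar -scalemxAl mxtraceZ.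
rewrite (mxtrace_mulC x^T x) -/s (mxtrace_mulC _ x) mulmxA.
have -> : 0 < \tr (x *m M *m x^T) - d * s = (0 < s * (\tr (x *m M *m x^T) - d * s)).
  by rewrite pmulr_rgt0.
have ds0 : 0 < d * s ^+ 2 by rewrite mulr_gt0// exprn_gt0.
nra.
Qed.

End PositiveDefinite.

(** * Barrier potentials *)

Section BarrierStep.
Context {R : realFieldType} {n : nat}.
Implicit Types (A B : 'M[R]_n) (v : 'rV[R]_n) (t d : R).

(** Here B = u - A, and C is B after the barrier has moved by d. By Sherman-Morrison the rank-one
    term raises the potential by t g / (1 - t b), with g = v C^-2 v^T and b = v C^-1 v^T; the
    hypothesis says that this is less than the drop [Delta] earned by the move. *)
Lemma upper_barrier_rank1 B d v t (C := B + d%:M)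
    (Delta := \tr (invmx B) - \tr (invmx C)) :
  0 < t -> posdef C -> 0 < Delta ->
  \tr (v *m (invmx C *m invmx C) *m v^T) / Delta + \tr (v *m invmx C *m v^T)
    < t^-1 ->
  posdef (C - t *: (v^T *m v)) /\
  \tr (invmx (C - t *: (v^T *m v))) <= \tr (invmx B).
Proof.
move=> t0 Cp D0; have Cu := posdef_unit _ Cp.
have := posdef_tr_ge0 _ (v *m invmx C) _ (posdef_scalar 1 ltr01).
rewrite mulmx1 trmx_mul (posdef_inv _ Cp).1 !mulmxA.
have := posdef_ge0 _ v (posdef_inv _ Cp).
set b := \tr (v *m _ *m v^T); set g := \tr (v *m _ *m _ *m v^T) => b0 g0 h.
have tb : t * b < 1.
  rewrite -ltr_pdivlMl// mulr1; apply: le_lt_trans h; rewrite lerDr.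
  by rewrite divr_ge0 ?(ltW D0).
split; first exact: posdef_sub_rank1.
have k0 : 0 < 1 - t * b by rewrite subr_gt0.
have e0 : 1 + (- t) * b != 0 by rewrite mulNr gt_eqF.
rewrite -scaleNr tr_inv_rank1 -/b// mulmxA -/g mulNr.
suff : t / (1 - t * b) * g <= Delta by rewrite !mulNr opprK /Delta; lra.
rewrite mulrAC ler_pdivrMr// -ler_pdivlMl//.
have {}h : g / Delta < t^-1 - b by rewrite ltrBrDr.
rewrite ltr_pdivrMr// in h; apply: le_trans (ltW h) _.
by rewrite le_eqVlt; apply/orP; left; apply/eqP; field; rewrite gt_eqF.
Qed.

(** Here C = A - l, and B is C after the barrier has moved up by d. The move costs [Delta], and the
    rank-one term wins back t g / (1 + t b), with g = v B^-2 v^T and b = v B^-1 v^T; the hypothesis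
    says that this suffices. *)
Lemma lower_barrier_rank1 B d v t (C := B + d%:M)
    (Delta := \tr (invmx B) - \tr (invmx C)) :
  0 < t -> posdef B -> 0 < Delta ->
  t^-1 <=
    \tr (v *m (invmx B *m invmx B) *m v^T) / Delta - \tr (v *m invmx B *m v^T) ->
  posdef (B + t *: (v^T *m v)) /\
  \tr (invmx (B + t *: (v^T *m v))) <= \tr (invmx C).
Proof.
move=> t0 Bp D0; have Bu := posdef_unit _ Bp.
have := posdef_ge0 _ v (posdef_inv _ Bp).
rewrite mulmxA.
set b := \tr (v *m _ *m v^T); set g := \tr (v *m _ *m _ *m v^T) => b0 h.
split; first by apply: posdef_add_rank1 => //; apply: ltW.
have k0 : 0 < 1 + t * b by rewrite ltr_pwDl// mulr_ge0// ltW.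
rewrite tr_inv_rank1 -/b ?gt_eqF// mulmxA -/g.
suff : Delta <= t / (1 + t * b) * g by rewrite /Delta; lra.
rewrite mulrAC ler_pdivlMr// mulrC -ler_pdivrMl//.
have {}h : t^-1 + b <= g / Delta by rewrite -lerBrDr.
rewrite ler_pdivlMr// in h; apply: le_trans h.
by rewrite le_eqVlt; apply/orP; left; apply/eqP; field; rewrite gt_eqF.
Qed.

End BarrierStep.

Definition barriers {R : realFieldType} {n : nat} (th : R) (A : 'M[R]_n) (l u : R) :=
  [/\ posdef (u%:M - A), posdef (A - l%:M),
      \tr (invmx (u%:M - A)) <= th & \tr (invmx (A - l%:M)) <= th].

Lemma exists_lt_of_sum_lt {R : realDomainType} m (f g : 'I_m -> R) :
  \sum_i f i < \sum_i g i -> exists i, f i < g i.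
Proof.
move=> fg; apply/existsP; apply: contraLR fg; rewrite negb_exists => /forallP h.
by rewrite -leNgt; apply: ler_sum => i _; rewrite leNgt.
Qed.

(** Averaging: the upper costs [fU] have a smaller sum over all rows than the lower gains [fL], so
    some row has [fU i < fL i], and t = 1 / [fL i] meets both barrier conditions. *)
Lemma barriers_step {R : realFieldType} {m n : nat} (U : 'M[R]_(m, n.+1)) (th : R)
    (A : 'M[R]_n.+1) (l u : R) :
  U^T *m U = 1%:M -> 0 < th -> th < 4^-1 -> barriers th A l u ->
  exists (i : 'I_m) (t : R), 0 < t /\
    barriers th (A + t *: ((row i U)^T *m row i U)) (l + 1) (u + (1 + 4 * th)).
Proof.
move=> UU th0 th1 [Hu Hl tru trl].
pose d : R := 1 + 4 * th.
have d0 : 0 < d by rewrite /d; lra.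
pose B := u%:M - A; pose C := B + d%:M.
have Cp : posdef C by apply: posdefD => //; apply: posdef_scalar.
pose L := A - (l + 1)%:M.
have LE : L + 1%:M = A - l%:M by rewrite /L raddfD/= opprD addrA subrK.
have Lp : posdef L.
  have -> : L = (A - l%:M) - 1%:M by rewrite -LE addrK.
  by apply: posdef_shift => //; rewrite mul1r; lra.
have inv0 (X : 'M[R]_n.+1) : posdef X -> invmx X != 0.
  move=> /posdef_unit Xu; apply/eqP => X0; have := mulmxV Xu.
  by rewrite X0 mulmx0 => /eqP; rewrite eq_sym oner_eq0.
have sq_gt0 (X : 'M[R]_n.+1) : posdef X -> 0 < \tr (invmx X *m invmx X).
  move=> Xp; have := posdef_tr_gt0 _ (invmx X) _ (posdef_scalar 1 ltr01) (inv0 _ Xp).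
  by rewrite mulmx1 (posdef_inv _ Xp).1.
(* Isotropy turns the sum of a form over the rows of [U] into a trace. *)
have sumU (X : 'M[R]_n.+1) : \sum_i \tr (row i U *m X *m (row i U)^T) = \tr X.
  by rewrite -tr_mul_mul_tr mxtrace_mulC mulmxA UU mul1mx.
have hU := tr_inv_shift B d d0 Hu Cp.
have hL : \tr (invmx L) - \tr (invmx (A - l%:M)) +
   (\tr (invmx L) - \tr (invmx (A - l%:M))) ^+ 2 <= \tr (invmx L *m invmx L).
  have := tr_inv_shift_sqr L 1 ltr01 Lp; rewrite LE !mul1r; apply=> //.
  by lra.
rewrite -/B in tru; rewrite -/C in hU.
pose DU := \tr (invmx B) - \tr (invmx C).
pose DL := \tr (invmx L) - \tr (invmx (A - l%:M)).
rewrite -/DU in hU; rewrite -/DL in hL.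
have DU0 : 0 < DU by apply: lt_le_trans hU; rewrite mulr_gt0// sq_gt0.
have DL0 : 0 < DL.
  have := tr_inv_shift L 1 ltr01 Lp; rewrite LE => /(_ Hl).
  by rewrite mul1r; apply: lt_le_trans; apply: sq_gt0.
pose fU i := \tr (row i U *m (invmx C *m invmx C) *m (row i U)^T) / DU
  + \tr (row i U *m invmx C *m (row i U)^T).
pose fL i := \tr (row i U *m (invmx L *m invmx L) *m (row i U)^T) / DL
  - \tr (row i U *m invmx L *m (row i U)^T).
have sU : \sum_i fU i <= d^-1 + th.
  rewrite big_split/= -mulr_suml !sumU; apply: lerD; last by rewrite /DU in DU0; lra.
  by rewrite ler_pdivrMr// ler_pdivlMl.
(* The sum is tr L^-2 / DL - tr L^-1, at least 1 + DL - tr L^-1 by [hL]; this equals 1 - tr (A -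
   l)^-1. *)
have sL : 1 - th <= \sum_i fL i.
  rewrite sumrB/= -mulr_suml !sumU lerBrDr ler_pdivlMr//.
  apply: le_trans hL; have -> : DL + DL ^+ 2 = (1 + DL) * DL by ring.
  rewrite ler_pM2r//.
  by rewrite /DL; lra.
have [|i fi] := exists_lt_of_sum_lt _ fU fL.
  (* The inequality 1 / d + th < 1 - th amounts to 2 th (1 - 4 th) > 0; hence the shift d = 1 + 4 th
     and the hypothesis th < 1/4. *)
  apply: le_lt_trans sU _; apply: lt_le_trans sL.
  rewrite -ltrBrDr -ltf_pV2 ?posrE ?invr_gt0//; last by lra.
  rewrite invrK -[X in X < _]mulr1 ltr_pdivrMl; last by lra.
  by rewrite /d; nra.
have fU0 : 0 <= fU i.
  rewrite addr_ge0 ?(posdef_ge0 _ _ (posdef_inv _ Cp))//.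
  rewrite divr_ge0 ?(ltW DU0)//.
  have := posdef_ge0 _ (row i U *m invmx C) (posdef_scalar 1 ltr01).
  by rewrite mulmx1 trmx_mul (posdef_inv _ Cp).1 !mulmxA.
have fL0 : 0 < fL i by apply: le_lt_trans fi.
exists i, (fL i)^-1; rewrite invr_gt0; split=> //.
have [||||up1 up2] := upper_barrier_rank1 B d (row i U) (fL i)^-1 => //.
  by rewrite invr_gt0.
  by rewrite invrK.
have [||||lo1 lo2] := lower_barrier_rank1 L 1 (row i U) (fL i)^-1 => //.
- by rewrite invr_gt0.
- by rewrite LE.
- by rewrite LE invrK.
rewrite LE in lo2; set V := _ *: _ in up1 up2 lo1 lo2 *.
have uE : (u + (1 + 4 * th))%:M - (A + V) = B + d%:M - V.
  by rewrite raddfD/= opprD addrA [X in X - V]addrAC.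
have lE : A + V - (l + 1)%:M = L + V by rewrite addrAC.
by split; rewrite ?uE ?lE//; [exact: le_trans up2 _|exact: le_trans lo2 _].
Qed.

Lemma barriers_iterate {R : realFieldType} {m n : nat} (U : 'M[R]_(m, n.+1)) (th : R)
    (T : nat) :
  U^T *m U = 1%:M -> 0 < th -> th < 4^-1 ->
  exists s : 'I_m -> R, [/\ forall i, 0 <= s i, (#|[set i | s i != 0%R]| <= T)%N &
    barriers th (\sum_i s i *: ((row i U)^T *m row i U))
      (T%:R - n.+1%:R / th) (T%:R * (1 + 4 * th) + n.+1%:R / th)].
Proof.
move=> UU th0 th1; elim: T => [|T [s [s0 sT sb]]].
  exists (fun=> 0); split=> //.
    by rewrite leqn0 cards_eq0; apply/eqP/setP => i; rewrite !inE eqxx.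
  rewrite big1 => [|i _]; last by rewrite scale0r.
  rewrite mulr0n mul0r !add0r.
  (* At A = 0 the barriers start at distance (n + 1) / th on either side, where both potentials
     equal th. *)
  have a0 : 0 < n.+1%:R / th by rewrite divr_gt0// ltr0n.
  have trE : \tr (invmx (n.+1%:R / th)%:M : 'M[R]_n.+1) <= th.
    rewrite invmx_scalar mxtrace_scalar invf_div -[leLHS]mulr_natr divfK//.
    by rewrite pnatr_eq0.
  by split; rewrite ?sub0r ?subr0 ?raddfN/= ?opprK ?add0r//; apply: posdef_scalar.
have [i [t [t0 tb]]] := barriers_step U th _ _ _ UU th0 th1 sb.
(* A row may be chosen repeatedly; its weights add up, so T steps use at most T rows. *)
exists (fun j => s j + (j == i)%:R * t); split.
- by move=> j; rewrite addr_ge0// mulr_ge0// ltW.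
- have /subset_leq_card/leq_trans-> // :
      [set j | s j + (j == i)%:R * t != 0] \subset i |: [set j | s j != 0].
    apply/subsetP => j; rewrite !inE; case: (eqVneq j i) => //= _.
    by rewrite mul0r addr0.
  by rewrite cardsU1; case: (_ \notin _); rewrite ?add1n ?add0n ?ltnS ?leqW.
have -> : \sum_j (s j + (j == i)%:R * t) *: ((row j U)^T *m row j U) =
    \sum_j s j *: ((row j U)^T *m row j U) + t *: ((row i U)^T *m row i U).
  under eq_bigr do rewrite scalerDl.
  rewrite big_split/=; congr (_ + _); rewrite (bigD1 i)//= big1.
    by rewrite addr0 eqxx mul1r.
  by move=> j /negbTE->; rewrite mul0r scale0r.
have -> : T.+1%:R - n.+1%:R / th = T%:R - n.+1%:R / th + 1 :> R.
  by rewrite -natr1; ring.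
have -> : T.+1%:R * (1 + 4 * th) + n.+1%:R / th =
   T%:R * (1 + 4 * th) + n.+1%:R / th + (1 + 4 * th) :> R.
  by rewrite -natr1; ring.
exact: tb.
Qed.

(** * Sparsification of quadratic forms *)

(** Gram-Schmidt on the columns: the residual [d] of the first column against [U] is either zero or,
    normalised, a new column. The factor [U] is in isotropic position even when [V] is rank
    deficient. *)
Lemma orthonormal_factorization {R : rcfType} {m n : nat} (V : 'M[R]_(m, n)) :
  exists (r : nat) (U : 'M[R]_(m, r)) (Y : 'M[R]_(r, n)),
    [/\ (r <= n)%N, U^T *m U = 1%:M & V = U *m Y].
Proof.
elim: n V => [|n IH] V.
  by exists 0%N, 0, 0; split; rewrite ?thinmx0// [LHS]flatmx0 [RHS]flatmx0.
move: V; rewrite -[n.+1]/(1 + n)%N => V.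
have [r [U [Y [rn UU VE]]]] := IH (rsubmx V).
pose c := lsubmx V; pose d := c - U *m (U^T *m c).
have cE : c = d + U *m (U^T *m c) by rewrite subrK.
have {}VE : V = row_mx c (U *m Y) by rewrite -VE hsubmxK.
have [d0|d0] := eqVneq d 0.
  exists r, U, (row_mx (U^T *m c) Y); split=> //; first exact: leqW.
  by rewrite mul_mx_row [LHS]VE {1}cE d0 add0r.
have s0 : 0 < \tr (d^T *m d).
  have := posdef_tr_gt0 _ d^T _ (posdef_scalar 1 ltr01).
  by rewrite mulmx1 trmxK; apply; rewrite trmx_eq0.
set s := \tr _ in s0; pose a := Num.sqrt s.
have a0 : a != 0 by rewrite gt_eqF// sqrtr_gt0.
have dU : d^T *m U = 0.
  by rewrite linearB/= !trmx_mul trmxK mulmxBl -!mulmxA UU mulmx1 subrr.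
exists (1 + r)%N, (row_mx (a^-1 *: d) U), (block_mx a%:M 0 (U^T *m c) Y).
split; first by rewrite ltnS.
  rewrite tr_row_mx mul_col_row [(_ *: d)^T]linearZ/= -!scalemxAl -!scalemxAr dU.
  rewrite -[U^T *m d]trmxK trmx_mul trmxK dU trmx0 !scaler0 UU.
  rewrite [_^T *m _]mx11_scalar_tr -/s scalerA scale_scalar_mx -invfM -expr2.
  rewrite sqr_sqrtr ?(ltW s0)// mulVf ?gt_eqF//.
  by rewrite -scalar_mx_block.
rewrite mul_row_block mulmx0 add0r mul_mx_scalar scalerA divff// scale1r.
by rewrite -cE.
Qed.

Lemma quadratic_sparsifier {R : realType} {m k : nat} (V : 'M[R]_(m, k)) (eps : R) :
  0 < eps -> eps < 1 ->
  exists s : 'I_m -> R, [/\ forall i, 0 <= s i,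
    #|[set i | s i != 0%R]|%:R <= 26 * eps ^- 2 * k%:R &
    forall x : 'cV[R]_k,
      (1 - eps) * \sum_i (V *m x) i 0 ^+ 2 <= \sum_i s i * (V *m x) i 0 ^+ 2 /\
      \sum_i s i * (V *m x) i 0 ^+ 2 <= (1 + eps) * \sum_i (V *m x) i 0 ^+ 2].
Proof.
move=> e0 e1; have [[|r] [U [Y [rk UU ->]]]] := orthonormal_factorization V.
  (* Rank 0 is set apart: the barrier argument divides by potential drops, which are positive only
     in nonzero dimension. *)
  exists (fun=> 0); split=> // [|x].
    rewrite (_ : [set _ | _] = set0) ?cards0; last first.
      by apply/setP => i; rewrite !inE eqxx.
    by rewrite !mulr_ge0 ?invr_ge0 ?exprn_ge0 ?(ltW e0).
  rewrite [U]thinmx0 mul0mx mul0mx.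
  by rewrite !big1 ?mulr0// => i _; rewrite mxE ?expr0n ?mulr0.
(* Since th^-2 = 25 / eps^2 and 1 <= eps^-2, the integer [q] just above th^-2 is at most 26 /
   eps^2. *)
pose th := eps / 5; have th0 : 0 < th by rewrite divr_gt0.
pose q := (Num.truncn (th ^- 2)).+1; pose T := (q * r.+1)%N.
have [] : (Num.truncn (th ^- 2))%:R <= th ^- 2 /\ th ^- 2 < q%:R.
  by apply/andP/truncn_itv; rewrite invr_ge0 exprn_ge0 ?(ltW th0).
have ie : 1 <= eps ^- 2.
  by rewrite invf_ge1 ?exprn_gt0// exprn_ile1 ?(ltW e0) ?(ltW e1).
have thE : th ^- 2 = 25 * eps ^- 2 by rewrite /th; field; rewrite gt_eqF.
move=> q1 q2; have {}q1 : q%:R <= 26 * eps ^- 2 by rewrite /q -natr1; lra.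
have T0 : 0 < T%:R :> R by rewrite ltr0n.
have th1 : th < 4^-1 by rewrite /th; lra.
have [s [s0 sT [up lo _ _]]] := barriers_iterate U th T UU th0 th1.
exists (fun i => s i / T%:R); split.
- by move=> i; rewrite divr_ge0 ?(ltW T0).
- rewrite (_ : [set _ | _] = [set i | s i != 0]); last first.
    by apply/setP => i; rewrite !inE mulf_eq0 invr_eq0 (gt_eqF T0) orbF.
  have : T%:R <= 26 * eps ^- 2 * k%:R :> R.
    by rewrite natrM ler_pM// ler_nat.
  by apply: le_trans; rewrite ler_nat.
move=> x; rewrite -mulmxA; set y := Y *m x.
have rowE i : (U *m y) i 0 = \tr (y^T *m (row i U)^T).
  by rewrite -trmx_mul mxtrace_tr -row_mul /mxtrace big_ord1 [RHS]mxE.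
have QE : \sum_i (U *m y) i 0 ^+ 2 = \tr (y^T *m y).
  have -> : y^T *m y = (U *m y)^T *m (U *m y).
    by rewrite (trmx_mul U y) -(mulmxA y^T) (mulmxA U^T U y) UU mul1mx.
  rewrite /mxtrace big_ord1 mxE; apply: eq_bigr => i _.
  by rewrite [_^T _ _]mxE expr2.
set A := \sum_i _ in up lo.
have SE : \sum_i s i / T%:R * (U *m y) i 0 ^+ 2 = \tr (y^T *m A *m y) / T%:R.
  rewrite mulmx_sumr mulmx_suml raddf_sum/= mulr_suml; apply: eq_bigr => i _.
  rewrite -scalemxAr -scalemxAl mxtraceZ rowE -tr_rank1 trmxK.
  by rewrite mulrAC.
have := posdef_ge0 _ y^T up; have := posdef_ge0 _ y^T lo.
rewrite trmxK !mulmxBr !mulmxBl !raddfB/= !mul_mx_scalar -!scalemxAl !mxtraceZ.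
rewrite mulmxBl raddfB/= -!scalemxAl !mxtraceZ QE SE.
set Q := \tr (y^T *m y); set S := \tr _.
have Q0 : 0 <= Q by rewrite /Q -QE sumr_ge0// => i _; rewrite sqr_ge0.
(* The initial offset is at most T th, so the final barriers lie between T (1 - th) and T (1 + 5 th)
   = T (1 + eps); dividing the weights by T gives the claim. *)
have rT : r.+1%:R / th <= T%:R * th.
  have : th^-1 <= q%:R * th.
    have := ler_wpM2r (ltW th0) (ltW q2).
    by rewrite expr2 invfM -mulrA mulVf ?gt_eqF// mulr1.
  by move=> /(ler_wpM2l (ler0n R r.+1)); rewrite natrM mulrCA mulrA.
move=> h1 h2; rewrite ler_pdivlMr// ler_pdivrMr//.
have h3 : r.+1%:R / th * Q <= T%:R * th * Q by rewrite ler_wpM2r.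
have ethE : eps = 5 * th by rewrite /th; field.
have TQ : 0 <= T%:R * th * Q.
  by apply: mulr_ge0 => //; apply: mulr_ge0; [exact: ler0n|exact: ltW].
rewrite ethE; move: h1 h2 h3 TQ.
move: (r.+1%:R / th) => a; move: (T%:R) (S) (Q) (th) => t S' Q' th' h1 h2 h3 TQ.
by split; lra.
Qed.

(** * Sparsification of CSP(P) *)

(** In the four-point form P itself tells a from b and c from d, so no distinctness or cardinality
    conditions remain. *)
Lemma singleton_restrictionP {D : finType} (P : D -> D -> bool) :
  has_singleton_restriction P <->
  exists a b c d, [/\ P a c, ~~ P a d, ~~ P b c & ~~ P b d].
Proof.
split=> [[B [C [B2 [C2 /eqP/cards1P[[a c] E]]]]]|[a [b [c [d [ac ad bc bd]]]]]].
  have Eac a' c' : a' \in B -> c' \in C -> P a' c' -> (a', c') = (a, c).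
    by move=> aB cC p; apply/set1P; rewrite -E !inE aB cC.
  have : (a, c) \in [set (a, c)] by rewrite inE.
  rewrite -E !inE => /andP[/andP[/= aB cC] ac].
  have other (X : {set D}) x : #|X| = 2%N -> x \in X -> exists2 y, y \in X & y != x.
    move=> X2 xX; move: X2; rewrite (cardsD1 x) xX => -[] /eqP/cards1P[y yE].
    by have := set11 y; rewrite -yE !inE => /andP[yx yX]; exists y.
  have [b bB ba] := other _ _ B2 aB; have [d dC dc] := other _ _ C2 cC.
  exists a, b, c, d; split=> //.
  - by apply/negP => /(Eac _ _ aB dC)[/eqP]; apply/negP.
  - by apply/negP => /(Eac _ _ bB cC)[/eqP]; apply/negP.
  - by apply/negP => /(Eac _ _ bB dC)[/eqP]; rewrite (negbTE ba).
have ba : a != b by apply: contraNneq bc => <-.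
have dc : c != d by apply: contraNneq ad => <-.
exists [set a; b], [set c; d]; rewrite !cards2 ba dc; split=> //; split=> //.
apply/eqP/cards1P; exists (a, c); apply/setP => -[x y]; rewrite !inE /= xpair_eqE.
case: (eqVneq x a) => [->|xa] /=.
  case: (eqVneq y c) => [->|yc] /=; first by rewrite ac.
  by case: (eqVneq y d) => [->|]//=; rewrite (negbTE ad).
case: (eqVneq x b) => [->|]//=.
case: (eqVneq y c) => [->|yc] /=; first by rewrite (negbTE bc).
by case: (eqVneq y d) => [->|]//=; rewrite (negbTE bd).
Qed.

(* The colours are the zero sets [set b | ~~ P a b]; None colours the b that lie
   in none of them. *)
Lemma no_singleton_coloring {D : finType} (P : D -> D -> bool) :
  ~ has_singleton_restriction P ->
  exists (C : finType) (f g : D -> C), forall a b, P a b = (f a != g b).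
Proof.
move=> nP; pose Z a := [set b | ~~ P a b].
have Zsub a a' b : b \in Z a -> b \in Z a' -> Z a \subset Z a'.
  rewrite !inE => ab a'b; apply/subsetP => c; rewrite !inE => ac.
  (* Otherwise the rows a', a and the columns c, b carry a single 1, at (a', c). *)
  apply/negP => a'c; apply: nP; apply/singleton_restrictionP.
  by exists a', a, c, b.
have Zeq a a' b : b \in Z a -> b \in Z a' -> Z a = Z a'.
  by move=> ab a'b; apply/eqP; rewrite eqEsubset !(Zsub _ _ b).
exists (option {set D}), (fun a => Some (Z a)),
  (fun b => omap Z [pick a | ~~ P a b]) => a b.
apply/idP/idP; last first.
  apply: contraNT => ab; case: pickP => [a' a'b|/(_ a)]; last by rewrite ab.
  by apply/eqP; congr Some; apply: (Zeq _ _ b); rewrite inE.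
move=> ab; case: pickP => [a' a'b|]//=; apply/negP => /eqP[/setP/(_ b)].
by rewrite !inE ab a'b.
Qed.

(** Two distinct colours are separated by exactly two colour indicators, their own. *)
Lemma neq_sum_sqr {R : comNzRingType} {C : finType} (c d : C) :
  \sum_k ((c == k)%:R - (d == k)%:R) ^+ 2 = (c != d)%:R *+ 2 :> R.
Proof.
have [->|cd] := eqVneq c d.
  by rewrite big1 ?mul0rn// => k _; rewrite subrr expr0n.
rewrite (bigD1 c)//= (bigD1 d) 1?eq_sym//= big1 => [|k /andP[kc kd]].
  by rewrite !eqxx (negbTE cd) ?(eq_sym d) ?(negbTE cd) subr0 sub0r sqrrN !expr1n addr0.
by rewrite ![_ == k]eq_sym (negbTE kc) (negbTE kd) subrr expr0n.
Qed.

(** * The bipartite double cover *)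

Section DoubleCover.
Context {R : realType} {n : nat} (w : 'I_n -> 'I_n -> R).
Let E : finType := ('I_n * 'I_n)%type.

(* Row (u, v) is sqrt(w u v) times the incidence row of the edge {u, v'} of the
   bipartite double cover, where u is lshift n u and v' is rshift n v. *)
Definition cover_incidence : 'M[R]_(#|E|, n + n) :=
  \matrix_(i, j) (Num.sqrt (w (enum_val i).1 (enum_val i).2) *
    ((j == lshift n (enum_val i).1)%:R - (j == rshift n (enum_val i).2)%:R)).

(** The two copies of a variable are coloured independently, by [f] on the left and [g] on the
    right; this is why the double cover is needed. *)
Definition color_class {C : finType} (f g : 'I_n -> C) (k : C) : 'cV[R]_(n + n) :=
  \col_j match split j with inl u => (f u == k)%:R | inr v => (g v == k)%:R end.

Lemma cover_incidence_color_class {C : finType} (f g : 'I_n -> C) (k : C) i :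
  (cover_incidence *m color_class f g k) i 0 =
  Num.sqrt (w (enum_val i).1 (enum_val i).2) *
    ((f (enum_val i).1 == k)%:R - (g (enum_val i).2 == k)%:R).
Proof.
rewrite mxE.
under eq_bigr do rewrite mxE -mulrA.
rewrite -mulr_sumr; congr (_ * _).
under eq_bigr do rewrite mulrBl.
rewrite sumrB; have pick_sum (j0 : 'I_(n + n)) (F : 'I_(n + n) -> R) :
    \sum_j (j == j0)%:R * F j = F j0.
  rewrite (bigD1 j0)//= eqxx mul1r big1 ?addr0// => j /negbTE->.
  by rewrite mul0r.
rewrite !pick_sum !mxE.
by rewrite (unsplitK (inl _ : 'I_n + 'I_n)) (unsplitK (inr _ : 'I_n + 'I_n)).
Qed.

(** A satisfied constraint is an edge with ends of different colours, cut by exactly two colour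
    classes; hence the factor 1/2. The multiplier [s] is free so that one formula serves both the
    instance, at [s = 1], and its sparsifier. *)
Lemma csp_val_cover {D C : finType} (P : D -> D -> bool) (f g : D -> C)
    (A : 'I_n -> D) (s : 'I_#|E| -> R) :
  (forall u v, 0 <= w u v) -> (forall a b, P a b = (f a != g b)) ->
  csp_val P (fun u v => s (enum_rank ((u, v) : E)) * w u v) A =
  2^-1 * \sum_k \sum_i
    s i * (cover_incidence *m color_class (f \o A) (g \o A) k) i 0 ^+ 2.
Proof.
move=> w0 PE; rewrite exchange_big/= /csp_val pair_bigA/=.
rewrite (reindex (@enum_val E E)) /=; last first.
  by apply: onW_bij; exact: enum_val_bij.
rewrite mulr_sumr; apply: eq_bigr => i _.
under [in RHS]eq_bigr do rewrite cover_incidence_color_class exprMn sqr_sqrtr//.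
rewrite -mulr_sumr -mulr_sumr neq_sum_sqr -PE -mulr_natr -surjective_pairing enum_valK.
by field.
Qed.

End DoubleCover.

Lemma exists_sparsifier {R : realType} {D : finType} (P : D -> D -> bool)
    (eps : R) {n : nat} (w : 'I_n -> 'I_n -> R) :
  ~ has_singleton_restriction P -> 0 < eps -> eps < 1 -> is_instance w ->
  exists w' : 'I_n -> 'I_n -> R, is_sparsifier P eps w w' /\
    (num_constraints w')%:R <= 52 * eps ^- 2 * n%:R.
Proof.
move=> /no_singleton_coloring[C [f [g PE]]] e0 e1 wI.
have w0 u v : 0 <= w u v by case: (wI u v).
have [s [s0 sT sQ]] := quadratic_sparsifier (cover_incidence w) eps e0 e1.
exists (fun u v => s (enum_rank (u, v)) * w u v); split.
  split; first by move=> u v; rewrite mulr_ge0.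
  split=> [u v ->|A]; first by rewrite mulr0.
  have -> : csp_val P w A =
      csp_val P (fun u v => (fun=> 1) (enum_rank (u, v)) * w u v) A.
    by apply: eq_bigr => u _; apply: eq_bigr => v _; rewrite mul1r.
  have cE r := csp_val_cover w P f g A r w0 PE.
  rewrite (cE (fun=> 1)) (cE s) 2!(mulrCA _ 2^-1).
  rewrite !ler_pM2l ?invr_gt0// !mulr_sumr.
  by split; apply: ler_sum => k _; under [X in _ * X]eq_bigr do rewrite mul1r;
    case: (sQ (color_class (f \o A) (g \o A) k)).
(* The double cover has 2 n vertices, which turns 26 into 52. *)
apply: le_trans (_ : 26 * eps ^- 2 * (n + n)%:R <= _); last by rewrite natrD; lra.
apply: le_trans sT; rewrite ler_nat /num_constraints.
rewrite -(card_imset _ enum_rank_inj); apply/subset_leq_card/subsetP => i.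
by case/imsetP => -[u v]; rewrite inE mulf_eq0 negb_or => /andP[suv _] ->; rewrite inE.
Qed.

(** * The quadratic lower bound *)

(** Every constraint points from the first half to the second, so the halves can take values in B
    and C independently even when B and C overlap. *)
Definition complete_bipartite (R : realType) (N : nat) (u v : 'I_(N + N)) : R :=
  ((u < N) && (N <= v))%N%:R.

Lemma complete_bipartite_dense {R : realType} {D : finType} (P : D -> D -> bool)
    (eps : R) (N : nat) (w' : 'I_(N + N) -> 'I_(N + N) -> R) :
  has_singleton_restriction P -> eps < 1 ->
  is_sparsifier P eps (complete_bipartite R N) w' -> (N * N <= num_constraints w')%N.
Proof.
move=> /singleton_restrictionP[a [b [c [d [ac ad bc bd]]]]] e1 [w'0 [w'w sp]].
have w'n0 (u v : 'I_(N + N)) : (u < N)%N -> (N <= v)%N -> w' u v != 0.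
  move=> uN vN; apply/eqP => w'uv.
  (* Under this assignment (u, v) is the only satisfied constraint. *)
  pose A (k : 'I_(N + N)) :=
    if (k < N)%N then if k == u then a else b else if k == v then c else d.
  have [+ _] := sp A.
  have -> : csp_val P w' A = 0.
    rewrite /csp_val big1// => x _; rewrite big1// => y _.
    have := w'w x y; rewrite /complete_bipartite /A.
    case: ltnP => [xN|_]; last by move=> ->//; rewrite mul0r.
    case: ltnP => [_ ->|yN _]//; first by rewrite mul0r.
    case: eqVneq => [->|_]; case: eqVneq => [->|_].
    - by rewrite w'uv mul0r.
    - by rewrite (negbTE ad) mulr0.
    - by rewrite (negbTE bc) mulr0.
    - by rewrite (negbTE bd) mulr0.
  (* The lower bound fails: [(u, v)] alone gives the original instance a positive value, and
     [eps < 1]. *)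
  apply/negP; rewrite -ltNge mulr_gt0 ?subr_gt0//.
  have t0 x y : 0 <= complete_bipartite R N x y * (P (A x) (A y))%:R.
    by rewrite mulr_ge0.
  rewrite /csp_val (bigD1 u)//= ltr_pwDl//; last first.
    by apply: sumr_ge0 => x _; apply: sumr_ge0 => y _.
  rewrite (bigD1 v)//= ltr_pwDl//; last by apply: sumr_ge0.
  by rewrite /complete_bipartite /A uN vN ltnNge vN !eqxx ac mulr1.
have inj : injective (fun p : 'I_N * 'I_N => (lshift N p.1, rshift N p.2)).
  by move=> [i j] [i' j'] [] /val_inj/= -> /addnI/val_inj ->.
rewrite -{1 2}(card_ord N) -card_prod -(card_imset _ inj).
apply/subset_leq_card/subsetP => _ /imsetP[[i j] _ ->]; rewrite inE.
by apply: w'n0; rewrite //= leq_addr.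
Qed.

Theorem theorem2 (R : realType) (D : finType) (P : D -> D -> bool) :
  (1 < #|D|)%N ->
  (has_singleton_restriction P ->
     forall eps : R, 0 < eps -> eps < 1 ->
     exists2 c : R, 0 < c &
       forall N : nat, exists n : nat, (N <= n)%N /\
         exists w : 'I_n -> 'I_n -> R, is_instance w /\
           forall w' : 'I_n -> 'I_n -> R, is_sparsifier P eps w w' ->
             c * (n%:R) ^+ 2 <= (num_constraints w')%:R)
  /\
  (~ has_singleton_restriction P ->
     exists2 K : R, 0 < K &
       forall eps : R, 0 < eps -> eps < 1 ->
       forall (n : nat) (w : 'I_n -> 'I_n -> R), is_instance w ->
         exists w' : 'I_n -> 'I_n -> R, is_sparsifier P eps w w' /\
           (num_constraints w')%:R <= K * eps ^- 2 * n%:R).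
Proof.
move=> _; split=> [sP eps e0 e1|nP]; last first.
  by exists 52 => // eps e0 e1 n w; apply: exists_sparsifier.
(* With n = 2 N, the N^2 constraints number n^2 / 4. *)
exists 4^-1; first by rewrite invr_gt0.
move=> N; exists (N + N)%N; split; first exact: leq_addr.
exists (complete_bipartite R N); split.
  move=> u v; split=> [|->]; first exact: ler0n.
  by rewrite /complete_bipartite; case: ltnP.
move=> w' /(complete_bipartite_dense _ _ _ _ sP e1).
rewrite -(ler_nat R) natrM; apply: le_trans.
by rewrite natrD le_eqVlt; apply/orP; left; apply/eqP; field.
Qed.
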